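(* Let $k\geq 1$ and $n\geq 2$ be integers, and let $f_k$ be the $k$-regulous function on $\mathbb{R}^n$ given by $$f_k=\frac{x^{2+2k}}{x^2+y^2},$$ where $x,y$ denote the first two coordinates on $\mathbb{R}^n$ (and $f_k$ is extended by $0$ to the set $\{x=y=0\}$). Then $f_k$ is not a sum of squares in $\mathcal{R}^k(\mathbb{R}^n)$.
   Context: For an integer $k\ge 0$, a function $f:\mathbb{R}^n\to\mathbb{R}$ is called $k$-regulous if it is of class $\mathcal{C}^k$ and is a rational function, i.e. there is a non-empty Zariski open subset $U\subset\mathbb{R}^n$ such that $f|_U$ is regular (a quotient of polynomials whose denominator does not vanish on $U$). The ring of $k$-regulous functions on $\mathbb{R}^n$ is denoted $\mathcal{R}^k(\mathbb{R}^n)$. A sum of squares in a ring is a finite sum of squares of elements of that ring. *)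

(* Defs.v *)
From HB Require Import structures.
From mathcomp Require Import all_boot all_order all_algebra.
From mathcomp Require Import all_classical all_reals all_analysis.
(* mpoly is not imported: its notations clash with those of analysis. *)
From mathcomp Require mpoly.

Set Implicit Arguments.
Unset Strict Implicit.
Unset Printing Implicit Defensive.

Import Order.TTheory GRing.Theory Num.Theory.
Import numFieldNormedType.Exports.

Local Open Scope classical_set_scope.
Local Open Scope ring_scope.

Definition peval (R : realType) (n : nat) (p : mpoly.mpoly n R)
    (x : 'rV[R]_n) : R :=
  mpoly.meval (fun i => x ord0 i) p.

Definition zariski_closed (R : realType) (n : nat) (Z : set 'rV[R]_n) : Prop :=
  exists S : set (mpoly.mpoly n R),
    Z = [set x | forall p, S p -> peval p x = 0].

Definition zariski_open (R : realType) (n : nat) (U : set 'rV[R]_n) : Prop :=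
  zariski_closed (~` U).

Definition regular_on (R : realType) (n : nat) (U : set 'rV[R]_n)
    (f : 'rV[R]_n -> R) : Prop :=
  exists p q : mpoly.mpoly n R,
    forall x, U x -> peval q x != 0 /\ f x = peval p x / peval q x.

Definition rational_fun (R : realType) (n : nat) (f : 'rV[R]_n -> R) : Prop :=
  exists U : set 'rV[R]_n, [/\ zariski_open U, U !=set0 & regular_on U f].

(* All iterated partial derivatives of order at most k, taken in any order,
   exist everywhere and are continuous; delta_mx ord0 i is the i-th vector of
   the canonical basis. *)
Fixpoint classC (R : realType) (n k : nat) (f : 'rV[R]_n -> R) : Prop :=
  continuous f /\
  (if k is j.+1 then
     forall i : 'I_n, (forall x, derivable f x (delta_mx ord0 i)) /\
       classC j (fun x => 'D_(delta_mx ord0 i) f x)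
   else True).

Definition regulous (R : realType) (n k : nat) : set ('rV[R]_n -> R) :=
  [set f | classC k f /\ rational_fun f].
Arguments regulous : clear implicits.

(* S is the carrier of a subring of A: the squares are squares of elements of
   S, and the operations are those of A. *)
Definition sum_of_squares (A : pzRingType) (S : set A) (a : A) : Prop :=
  exists (m : nat) (g : 'I_m -> A),
    (forall i, S (g i)) /\ a = \sum_(i < m) g i ^+ 2.

(* The proofs in the ordinals fix the indices: x has index 0, y has index 1. *)
Definition fk (R : realType) (n k : nat) (hn : (2 <= n)%N)
    (v : 'rV[R]_n) : R :=
  let x := v ord0 (Ordinal (ltnW hn)) in
  let y := v ord0 (Ordinal hn) in
  if (x == 0) && (y == 0) then 0
  else x ^+ (2 + 2 * k) / (x ^+ 2 + y ^+ 2).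

(* Main.v *)
Require Import Defs.
From HB Require Import structures.
From mathcomp Require Import all_boot all_order all_algebra.
From mathcomp Require Import all_classical all_reals all_analysis.
From mathcomp Require Import (canonicals) mpoly.
From mathcomp Require Import zify ring.

(* [f_k] is homogeneous of degree [2k] in [(x, y)], hence of class [C^(2k-1)],
   so of class [C^k].  If [f_k] were a sum of squares of functions [g_l] of
   class [C^k], then [g_l^2 <= f_k] would force the Taylor expansion of [g_l] at
   the origin to start in degree [k]: along the ray [(t, ts)], the quotient
   [g_l / t^k] tends to a polynomial [q_l(s)].  Dividing by [t^(2k)] and letting
   [t] tend to 0 gives [1 / (1 + s^2) = \sum_l q_l(s)^2], which is impossible
   since [1 / (1 + s^2)] is not a polynomial. *)

Set Implicit Arguments.
Unset Strict Implicit.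
Unset Printing Implicit Defensive.

Import Order.TTheory GRing.Theory Num.Theory.
Import numFieldNormedType.Exports.

Local Open Scope classical_set_scope.
Local Open Scope ring_scope.

(** * Polynomial primitives and derivatives along lines *)

(** Only the positive integers are inverted, so this covers primitives over [R] and, for two
    variables, over [{poly R}]. *)
Lemma poly_primitive (A : unitRingType) (p : {poly A}) :
  (forall m, m.+1%:R \is a @GRing.unit A) ->
  exists q : {poly A}, q^`() = p /\ q.[0] = 0.
Proof.
move=> unitS; exists (\poly_(l < (size p).+1) (l%:R^-1 * p`_l.-1)).
split; last by rewrite horner_coef0 coef_poly invr0 mul0r.
apply/polyP => l; rewrite coef_deriv coef_poly ltnS.
case: ltnP => [_|hl]; last by rewrite mul0rn nth_default.
by rewrite -[LHS]mulr_natl mulVKr.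
Qed.

Lemma natS_unit_polyC (R : numFieldType) m : m.+1%:R \is a @GRing.unit {poly R}.
Proof.
by rewrite -polyC_natr rmorph_unit// unitfE pnatr_eq0.
Qed.

(** Freezing the inner variable first exhibits a bivariate polynomial as a univariate one in the
    outer variable, ready for one-variable calculus. *)
Lemma horner_map_eval (A : comNzRingType) (p : {poly {poly A}}) (x y : A) :
  (map_poly (horner_eval y) p).[x] = p.[x%:P].[y].
Proof.
rewrite -[x in LHS](hornerC x y) -[_.[y] in LHS]/(horner_eval y _).
exact: horner_map.
Qed.

Lemma is_derive_line (R : realType) (V : normedModType R) (g : V -> R)
    (v w : V) (z : R) : derivable g (z *: v + w) v ->
  is_derive z (1 : R) (fun t : R => g (t *: v + w)) ('D_v g (z *: v + w)).
Proof.
rewrite /derivable => dg.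
suff E : (fun h : R => h^-1 *:
    (((fun t : R => g (t *: v + w)) \o shift z) (h *: 1) - g (z *: v + w))) =
  (fun h : R => h^-1 *: ((g \o shift (z *: v + w)) (h *: v) - g (z *: v + w))).
  by split; rewrite /derivable /derive E.
by apply/funext => h /=; rewrite [_%:A]mulr1 scalerDl addrA.
Qed.

Lemma dist_le_of_derive_bound (R : realType) (f df : R -> R) (x B : R) :
  (forall z : R, is_derive z (1 : R) f (df z)) ->
  (forall z, `|z| <= `|x| -> `|df z| <= B) ->
  `|f x - f 0| <= B * `|x|.
Proof.
move=> fdf dfB.
have fc a b : {within `[a, b], continuous f}.
  apply: continuous_subspaceT => z.
  by apply/differentiable_continuous/derivable1_diffP; case: (fdf z).
have [x0|x0] := leP 0 x.
  have [c /[!in_itv]/= /andP[c0 cx] ->] :=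
    MVT_segment x0 (fun z _ => fdf z) (fc 0 x).
  by rewrite subr0 normrM ler_wpM2r// dfB// !ger0_norm.
have [c /[!in_itv]/= /andP[xc c0] E] :=
  MVT_segment (ltW x0) (fun z _ => fdf z) (fc x 0).
rewrite distrC E normrM sub0r normrN ler_wpM2r// dfB//.
by rewrite !ler0_norm ?lerN2// ltW.
Qed.

(** * Taylor expansion on a coordinate plane *)

Section plane.
Context {R : realType} {n : nat} (i j : 'I_n).
Implicit Types (g : 'rV[R]_n -> R).

Definition plane_pt (x y : R) : 'rV[R]_n :=
  x *: delta_mx ord0 i + y *: delta_mx ord0 j.

(* The outer variable of [p] is x.  If [p1], [p2] are the expansions of the
   partial derivatives of [g] in x and y, then [g] has the expansion
   [P + r + g 0], where [P] is the primitive of [p1] in x vanishing at x = 0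
   and [r] the primitive of [p2.[0]] vanishing at y = 0; the remainder is
   bounded by the mean value theorem along the path (0,0), (0,y), (x,y). *)
Lemma plane_taylor k g : classC k g ->
  exists p : {poly {poly R}}, forall e : R, 0 < e ->
  exists2 d : R, 0 < d & forall x y : R, `|x| + `|y| < d ->
    `|g (plane_pt x y) - p.[x%:P].[y]| <= e * (`|x| + `|y|) ^+ k.
Proof.
elim: k g => [|k IH] g.
  case=> gc _; exists (g 0)%:P%:P => e e0.
  have /cvgrPdist_le/(_ _ e0)/nbhs_normP[d /= d0 dg] := gc 0.
  (* [plane_pt x y] has norm at most [C * (|x| + |y|)]; the summand 1 makes [C] positive. *)
  pose C : R :=
    `|delta_mx ord0 i : 'rV[R]_n| + `|delta_mx ord0 j : 'rV[R]_n| + 1.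
  have C0 : 0 < C by rewrite ltr_wpDl// addr_ge0.
  exists (d / C); first by rewrite divr_gt0.
  move=> x y; rewrite ltr_pdivlMr// => xyd.
  rewrite !hornerC expr0 mulr1 distrC; apply: dg => /=.
  rewrite sub0r normrN (le_lt_trans _ xyd)// (le_trans (ler_normD _ _))//.
  rewrite !normrZ mulrDl lerD// ler_wpM2l// /C.
    by rewrite -addrA lerDl addr_ge0.
  by rewrite addrAC lerDr addr_ge0.
case=> gc dg.
have [dgi /IH[p1 hp1]] := dg i.
have [dgj /IH[p2 hp2]] := dg j.
have [P [dP P0]] := poly_primitive p1 (@natS_unit_polyC R).
have unitR m : m.+1%:R \is a @GRing.unit R by rewrite unitfE pnatr_eq0.
have [r [dr r0]] := poly_primitive p2.[0] unitR.
exists (P + (r + (g 0)%:P)%:P) => e e0.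
have [d1 d10 {}hp1] := hp1 _ e0.
have [d2 d20 {}hp2] := hp2 _ e0.
exists (Num.min d1 d2); first by rewrite lt_min d10.
move=> x y; rewrite lt_min => /andP[xy1 xy2].
set M := `|x| + `|y|.
pose h (x y : R) := g (plane_pt x y) - (P + (r + (g 0)%:P)%:P).[x%:P].[y].
rewrite -/(h x y).
have hx (z : R) : is_derive z (1 : R) (fun t => h t y)
    ('D_(delta_mx ord0 i) g (plane_pt z y) - p1.[z%:P].[y]).
  rewrite /h.
  have -> : (fun t => g (plane_pt t y) - (P + (r + (g 0)%:P)%:P).[t%:P].[y]) =
    (fun t : R => g (t *: delta_mx ord0 i + y *: delta_mx ord0 j)) -
    (horner (map_poly (horner_eval y) (P + (r + (g 0)%:P)%:P))).
    apply/funext => t; rewrite -[RHS]/(_ - _); congr (_ - _).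
    by rewrite horner_map_eval.
  apply: is_deriveB; first exact: is_derive_line.
  apply: is_derive_eq; rewrite deriv_map derivD derivC addr0 dP.
  by rewrite horner_map_eval.
have hy (z : R) : is_derive z (1 : R) (fun t => h 0 t)
    ('D_(delta_mx ord0 j) g (plane_pt 0 z) - p2.[0].[z]).
  rewrite /h.
  (* On x = 0 the primitive [P] vanishes, so only [r + g 0] is left to differentiate in y. *)
  have -> : (fun t => g (plane_pt 0 t) - (P + (r + (g 0)%:P)%:P).[0%:P].[t]) =
    (fun t : R => g (t *: delta_mx ord0 j + 0 *: delta_mx ord0 i)) -
    (horner (r + (g 0)%:P)).
    apply/funext => t; rewrite -[RHS]/(_ - _); congr (_ - _).
      by rewrite /plane_pt addrC.
    by rewrite hornerD P0 hornerC add0r.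
  apply: is_deriveB.
    rewrite /plane_pt addrC; exact: is_derive_line.
  by apply: is_derive_eq; rewrite derivD derivC addr0 dr.
have h0 : h 0 0 = 0.
  rewrite /h /plane_pt !scale0r addr0 hornerD P0 hornerC add0r.
  by rewrite hornerD r0 hornerC add0r subrr.
have Hx : `|h x y - h 0 y| <= e * M ^+ k * `|x|.
  apply: (dist_le_of_derive_bound hx) => z zx.
  have zyM : `|z| + `|y| <= M by rewrite lerD2r.
  rewrite (le_trans (hp1 _ _ (le_lt_trans zyM xy1)))//.
  by rewrite ler_pM2l// lerXn2r// ?nnegrE ?addr_ge0.
have Hy : `|h 0 y - h 0 0| <= e * M ^+ k * `|y|.
  apply: (dist_le_of_derive_bound hy) => z zy.
  have zyM : `|0 : R| + `|z| <= M by rewrite normr0 add0r (le_trans zy)// lerDr.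
  have := hp2 _ _ (le_lt_trans zyM xy2).
  move/le_trans; apply.
  by rewrite ler_pM2l// lerXn2r// ?nnegrE ?addr_ge0.
rewrite h0 subr0 in Hy.
rewrite exprSr mulrA mulrDr (le_trans _ (lerD Hx Hy))//.
by rewrite -[X in `|X|](subrK (h 0 y)) ler_normD.
Qed.
End plane.

(** * Polynomials and leading coefficients along rays *)

(** In characteristic 0 the integers below [size p] are already too many distinct roots. *)
Lemma poly_eq0_of_horner (R : numDomainType) (p : {poly R}) :
  (forall x, p.[x] = 0) -> p = 0.
Proof.
move=> p0; apply/eqP/negPn/negP => pN0.
have := @max_poly_roots _ p [seq l%:R | l <- iota 0 (size p)] pN0.
rewrite size_map size_iota ltnn map_inj_uniq ?iota_uniq.
  move=> H; suff: false by []; apply: H => //.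
  by apply/allP => _ /mapP[l _ ->]; apply/rootP/p0.
by move=> l m /eqP; rewrite eqr_nat => /eqP.
Qed.

Lemma mul_sqrXDC1_neq1 (R : realFieldType) (p : {poly R}) :
  p * ('X^2 + 1%:P) <> 1.
Proof.
move=> E; have pN0 : p != 0.
  by apply/eqP => p0; move/eqP: E; rewrite p0 mul0r eq_sym oner_eq0.
have := congr1 (size \o polyseq) E; rewrite /= size_Mmonic ?monicXnaddC//.
by rewrite size_XnaddC// size_poly1 addnS /=; lia.
Qed.

(* In [S], the outer variable is [t] and the inner one is the slope [s]. *)
Lemma poly_along_ray (R : comNzRingType) (p : {poly {poly R}}) :
  exists S : {poly {poly R}}, forall t s, S.[t%:P].[s] = p.[t%:P].[t * s].
Proof.
(* Each coefficient is a polynomial in y, into which y = s t is substituted: ['X%:P] is s and the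
   outer ['X] is t. *)
exists (\sum_(l < size p) ((p`_l)^:P \Po ('X%:P * 'X)) * 'X^l) => t s.
rewrite (horner_coef p) !horner_sum.
apply: eq_bigr => l _; rewrite !hornerE horner_comp !hornerE.
congr (_ * _).
by rewrite -[X in X.[s]]/(p`_l \Po _) horner_comp !hornerE mulrC.
Qed.

(** By induction: if u = v X^k and |u(t)| <= C t^(k+1), then |v(t)| <= C t, so v(0) = 0 and v
    supplies one more factor X. *)
Lemma poly_bounded_factorXn (R : realType) (u : {poly R}) (C : R) k :
  (\forall t \near (0 : R)^'+, `|u.[t]| <= C * t ^+ k) ->
  exists v : {poly R}, u = v * 'X^k.
Proof.
elim: k => [|k IH] uC; first by exists u; rewrite expr0 mulr1.
have [v uE] : exists v : {poly R}, u = v * 'X^k.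
  apply: IH; near=> t.
  have t0 : 0 < t by near: t; exact: nbhs_right_gt.
  have t1 : t < 1 by near: t; exact: nbhs_right_lt.
  have ut : `|u.[t]| <= C * t ^+ k.+1 by near: t.
  have C0 : 0 <= C.
    by rewrite -(pmulr_lge0 _ (exprn_gt0 k.+1 t0)) (le_trans _ ut).
  rewrite (le_trans ut)// ler_wpM2l// exprS ler_piMl ?exprn_ge0// ltW//.
have v0 : v.[0] = 0.
  have vc : v.[t] @[t --> (0 : R)^'+] --> v.[0].
    by apply: cvg_at_right_filter; exact: continuous_horner.
  suff vc0 : v.[t] @[t --> (0 : R)^'+] --> (0 : R).
    exact: (cvg_unique (@norm_hausdorff _ _) vc vc0).
  apply/cvgr0Pnorm_le => e e0; near=> t.
  have t0 : 0 < t by near: t; exact: nbhs_right_gt.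
  have C0 : 0 < `|C| + 1 by rewrite ltr_wpDl.
  have te : t < e / (`|C| + 1).
    by near: t; apply: nbhs_right_lt; rewrite divr_gt0.
  have : `|u.[t]| <= C * t ^+ k.+1 by near: t.
  rewrite uE hornerM hornerXn normrM (ger0_norm (exprn_ge0 _ (ltW t0))).
  rewrite exprS mulrA ler_pM2r ?exprn_gt0// => /le_trans; apply.
  rewrite ltr_pdivlMr// mulrC in te.
  rewrite (le_trans _ (ltW te))// ler_wpM2r ?(ltW t0)//.
  by rewrite (le_trans (ler_norm C))// lerDl.
have /factor_theorem[w wE] : root v 0 by apply/rootP.
by exists w; rewrite uE wE subr0 -mulrA -exprS.
Unshelve. all: by end_near. Qed.

(** Since f = O(t^k) and f - u = o(t^k), also u = O(t^k). Hence u = v X^k, and f / t^k has the same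
    limit as v, namely v(0), the coefficient of X^k in u. *)
Lemma cvg_leading_coef (R : realType) (f : R -> R) (u : {poly R}) (C : R) k :
  (\forall t \near (0 : R)^'+, `|f t| <= C * t ^+ k) ->
  (f t - u.[t]) / t ^+ k @[t --> (0 : R)^'+] --> (0 : R) ->
  f t / t ^+ k @[t --> (0 : R)^'+] --> u`_k.
Proof.
move=> fC fu.
have [v uE] : exists v : {poly R}, u = v * 'X^k.
  (* [C] bounds f, and 1 eventually bounds the o(t^k) error, both relative to t^k. *)
  apply: (@poly_bounded_factorXn _ _ (C + 1)); near=> t.
  have t0 : 0 < t by near: t; exact: nbhs_right_gt.
  have ft : `|f t| <= C * t ^+ k by near: t.
  have : `|(f t - u.[t]) / t ^+ k| <= 1.
    by near: t; exact: (cvgr0Pnorm_le _).1 fu _ ltr01.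
  rewrite normrM normfV (ger0_norm (exprn_ge0 _ (ltW t0))).
  rewrite ler_pdivrMr ?exprn_gt0// mul1r => fut.
  rewrite mulrDl mul1r -[u.[t]](subKr (f t)).
  by rewrite (le_trans (ler_normB _ _))// lerD.
rewrite uE coefMXn ltnn subnn -horner_coef0 -[X in _ --> X]add0r.
have vc : v.[t] @[t --> (0 : R)^'+] --> v.[0].
  by apply: cvg_at_right_filter; exact: continuous_horner.
apply: cvg_trans (cvgD fu vc); apply: near_eq_cvg; near=> t.
have t0 : 0 < t by near: t; exact: nbhs_right_gt.
rewrite fctE uE hornerM hornerXn mulrBl mulfK ?subrK//.
by rewrite expf_neq0// gt_eqF.
Unshelve. all: by end_near. Qed.

Lemma ray_limit (R : realType) n (i j : 'I_n) k (g : 'rV[R]_n -> R)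
    (C : R -> R) :
  classC k g ->
  (forall s t, 0 < t -> `|g (plane_pt i j t (t * s))| <= C s * t ^+ k) ->
  exists q : {poly R}, forall s,
    g (plane_pt i j t (t * s)) / t ^+ k @[t --> (0 : R)^'+] --> q.[s].
Proof.
move=> gk gC; have [p hp] := plane_taylor i j gk.
have [S hS] := poly_along_ray p.
(* The coefficient of t^k is a polynomial in the slope, so a single witness serves all [s]. *)
exists S`_k => s.
rewrite -[X in _ --> X]/(horner_eval s S`_k) -coef_map.
apply: (@cvg_leading_coef _ _ _ (C s)).
  by near=> t; apply: gC; near: t; exact: nbhs_right_gt.
apply/cvgr0Pnorm_le => e e0.
(* On the ray |x| + |y| = t B, so the Taylor error is taken with e / B^k to leave e t^k. *)
pose B : R := 1 + `|s|.
have B0 : 0 < B by rewrite ltr_pwDl.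
have [d d0 hd] := hp (e / B ^+ k) (divr_gt0 e0 (exprn_gt0 k B0)).
near=> t.
have t0 : 0 < t by near: t; exact: nbhs_right_gt.
have td : t < d / B by near: t; apply: nbhs_right_lt; exact: divr_gt0.
have tE : `|t| + `|t * s| = t * B.
  by rewrite normrM (gtr0_norm t0) mulrDr mulr1.
rewrite horner_map_eval hS normrM normfV (ger0_norm (exprn_ge0 _ (ltW t0))).
rewrite ler_pdivrMr ?exprn_gt0//.
have := hd t (t * s); rewrite tE -ltr_pdivlMr// => /(_ td) /le_trans; apply.
by rewrite [t * B]mulrC exprMn mulrA divfK// expf_neq0// gt_eqF.
Unshelve. all: by end_near. Qed.

(** * Restriction of f_k to rays and the contradiction *)

Lemma fk_plane_pt (R : realType) (n k : nat) (hn : (2 <= n)%N) (t s : R) :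
  0 < t ->
  fk k hn (plane_pt (Ordinal (ltnW hn)) (Ordinal hn) t (t * s)) =
  (1 + s ^+ 2)^-1 * t ^+ k ^+ 2.
Proof.
move=> t0; have tN0 : t != 0 by rewrite gt_eqF.
have s0 : 1 + s ^+ 2 != 0 by rewrite gt_eqF// ltr_pwDl// sqr_ge0.
rewrite /fk !mxE /= mulr1 mulr0 addr0 mulr0 mulr1 add0r (negPf tN0) /=.
rewrite exprD mulnC exprM; field.
by rewrite s0 exprMn -[X in X + _]mulr1 -mulrDr mulf_neq0// expf_neq0.
Qed.

Lemma fk_not_sum_of_squares_classC (R : realType) (n k : nat) (hn : (2 <= n)%N)
    (m : nat) (g : 'I_m -> 'rV[R]_n -> R) :
  (forall l, classC k (g l)) -> fk k hn <> \sum_(l < m) g l ^+ 2.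
Proof.
move=> gk E.
set i := Ordinal (ltnW hn); set j := Ordinal hn.
have sumE s t : 0 < t ->
    \sum_(l < m) g l (plane_pt i j t (t * s)) ^+ 2 =
    (1 + s ^+ 2)^-1 * t ^+ k ^+ 2.
  by move=> t0; rewrite -(fk_plane_pt k hn)// E fct_sumE.
(* Each square is at most the whole sum, and 1 / (1 + s^2) <= 1, so the constant 1 works for every
   slope. *)
have gle l s t : 0 < t -> `|g l (plane_pt i j t (t * s))| <= 1 * t ^+ k.
  move=> t0; rewrite mul1r -ler_sqr ?nnegrE ?exprn_ge0 ?(ltW t0)//.
  rewrite real_normK ?num_real//.
  have gE : g l (plane_pt i j t (t * s)) ^+ 2 <=
      (1 + s ^+ 2)^-1 * t ^+ k ^+ 2.
    rewrite -sumE// (bigD1 l)//= lerDl sumr_ge0// => *; exact: sqr_ge0.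
  rewrite (le_trans gE)// ler_piMl ?sqr_ge0// invf_le1 ?lerDl ?sqr_ge0//.
  by rewrite ltr_pwDl// sqr_ge0.
have /fin_all_exists[q hq] l := ray_limit (gk l) (gle l).
pose W := \sum_(l < m) q l ^+ 2.
(* The same function of t is evaluated in the limit twice: term by term, and through its closed
   form, which is constant for t > 0. *)
have WE s : W.[s] = (1 + s ^+ 2)^-1.
  have lim1 : \sum_(l < m) (g l (plane_pt i j t (t * s)) / t ^+ k) ^+ 2
      @[t --> (0 : R)^'+] --> W.[s].
    rewrite /W horner_sum.
    apply: cvg_big => [|l _]; first exact: add_continuous.
    by rewrite expr2 hornerM; apply: cvgM; exact: hq.
  have lim2 : \sum_(l < m) (g l (plane_pt i j t (t * s)) / t ^+ k) ^+ 2
      @[t --> (0 : R)^'+] --> (1 + s ^+ 2)^-1.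
    have cst1 : (cst (1 + s ^+ 2)^-1 : R -> R) t @[t --> (0 : R)^'+] -->
        (1 + s ^+ 2)^-1 by exact: cvg_cst.
    apply: cvg_trans cst1; apply: near_eq_cvg; near=> t.
    have t0 : 0 < t by near: t; exact: nbhs_right_gt.
    under eq_bigr do rewrite expr_div_n.
    by rewrite -mulr_suml sumE// mulfK// !expf_neq0// gt_eqF.
  exact: (cvg_unique (@norm_hausdorff _ _) lim1 lim2).
apply: (@mul_sqrXDC1_neq1 _ W); apply/subr0_eq/poly_eq0_of_horner => s.
rewrite !hornerE WE [1 + _]addrC mulVf ?subrr//.
by rewrite gt_eqF// ltr_wpDl// sqr_ge0.
Unshelve. all: by end_near. Qed.

(** * Differentiability class of x^a y^b / (x^2 + y^2)^(c+1) *)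

Lemma continuous_lincomb (R : realType) (T : topologicalType) (r s : R)
    (f g : T -> R) :
  continuous f -> continuous g -> continuous (fun v => r * f v + s * g v).
Proof.
move=> fc gc v.
by apply: cvgD; apply: cvgM; by [exact: cvg_cst|exact: fc|exact: gc].
Qed.

Section partial_fraction.
Context {R : realType} {n : nat} (i j : 'I_n).
Implicit Types (v w : 'rV[R]_n).

(* [monofrac a b c] is 0 on the locus x = y = 0, since [0^-1 = 0] and the
   exponent of the denominator is positive. *)
Definition monofrac (a b c : nat) v : R :=
  v ord0 i ^+ a * v ord0 j ^+ b / (v ord0 i ^+ 2 + v ord0 j ^+ 2) ^+ c.+1.

Lemma sqrD_eq0 (x y : R) : (x ^+ 2 + y ^+ 2 == 0) = (x == 0) && (y == 0).
Proof. by rewrite paddr_eq0 ?sqr_ge0// !sqrf_eq0. Qed.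

(** With m = max(|x|, |y|), the numerator is at most m^(a+b) and the denominator at least
    m^(2(c+1)). As m <= M <= 1, the quotient is at most m^d <= M^d. *)
Lemma monofrac_bound a b c d v (M : R) : (c.+1.*2 + d <= a + b)%N ->
  0 <= M <= 1 -> `|v ord0 i| <= M -> `|v ord0 j| <= M ->
  `|monofrac a b c v| <= M ^+ d.
Proof.
move=> abc /andP[M0 M1]; rewrite /monofrac.
set x := v _ i; set y := v _ j => xM yM.
pose m := Num.max `|x| `|y|.
have m0 : 0 <= m by rewrite le_max normr_ge0.
have mM : m <= M by rewrite ge_max xM.
have m1 : m <= 1 := le_trans mM M1.
have mq : m ^+ 2 <= x ^+ 2 + y ^+ 2.
  rewrite /m; case: (leP `|x| `|y|) => _; rewrite real_normK ?num_real//.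
    by rewrite lerDr sqr_ge0.
  by rewrite lerDl sqr_ge0.
have [q0|qN0] := eqVneq (x ^+ 2 + y ^+ 2) 0.
  by rewrite q0 exprS mul0r invr0 mulr0 normr0 exprn_ge0.
have q_gt0 : 0 < x ^+ 2 + y ^+ 2 by rewrite lt_def qN0 addr_ge0 ?sqr_ge0.
rewrite !normrM normfV !normrX [in X in _ / X]gtr0_norm//.
rewrite ler_pdivrMr ?exprn_gt0//.
apply: (@le_trans _ _ (m ^+ (a + b))).
  by rewrite exprD ler_pM ?exprn_ge0// lerXn2r ?nnegrE// /m le_max lexx ?orbT.
apply: (@le_trans _ _ (m ^+ (d + c.+1.*2))).
  by rewrite ler_wiXn2l// addnC.
rewrite exprD -mul2n exprM ler_pM ?exprn_ge0 ?sqr_ge0//.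
  by rewrite lerXn2r ?nnegrE.
by rewrite lerXn2r ?nnegrE ?sqr_ge0// ltW.
Qed.

Lemma monofrac_axis a b c v : v ord0 i = 0 -> v ord0 j = 0 ->
  monofrac a b c v = 0.
Proof.
move=> vi vj; have q0 : v ord0 i ^+ 2 + v ord0 j ^+ 2 = 0.
  by apply/eqP; rewrite sqrD_eq0 vi vj eqxx.
by rewrite /monofrac q0 [0 ^+ c.+1]exprS mul0r invr0 mulr0.
Qed.

Lemma is_derive_coord (l : 'I_n) v w :
  is_derive v w (fun u : 'rV[R]_n => u ord0 l) (w ord0 l).
Proof.
suff H : (fun h : R => h^-1 *:
    (((fun u : 'rV[R]_n => u ord0 l) \o shift v) (h *: w) - v ord0 l))
    @ (0 : R)^' --> w ord0 l.
  split; first by apply/cvg_ex; exists (w ord0 l).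
  by apply: cvg_lim => //; exact: norm_hausdorff.
have cst1 : (cst (w ord0 l) : R -> R) h @[h --> (0 : R)^'] --> w ord0 l.
  exact: cvg_cst.
apply: cvg_trans cst1; apply: near_eq_cvg; near=> h.
have hN0 : h != 0 by near: h; exact: nbhs_dnbhs_neq.
by rewrite /= !mxE addrK scalerA mulVf// scale1r.
Unshelve. all: by end_near. Qed.

(** Homogeneity degree at least 2 makes the increment O(h^2), so the difference quotient tends to
    0. *)
Lemma is_derive_monofrac_axis a b c v w : (c.+1.*2 + 2 <= a + b)%N ->
  v ord0 i = 0 -> v ord0 j = 0 -> is_derive v w (monofrac a b c) 0.
Proof.
move=> abc vi vj.
suff H : (fun h : R => h^-1 *:
    ((monofrac a b c \o shift v) (h *: w) - monofrac a b c v))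
    @ (0 : R)^' --> (0 : R).
  split; first by apply/cvg_ex; exists (0 : R).
  by apply: cvg_lim => //; exact: norm_hausdorff.
rewrite monofrac_axis//; apply/cvgr0Pnorm_le => e e0.
pose N := `|w ord0 i| + `|w ord0 j| + 1.
have N0 : 0 < N by rewrite ltr_wpDl// addr_ge0.
near=> h.
have hN0 : h != 0 by near: h; exact: nbhs_dnbhs_neq.
have h1 : `|h| <= N^-1.
  by near: h; apply: dnbhs0_le; rewrite invr_gt0.
have h2 : `|h| <= e / N ^+ 2.
  by near: h; apply: dnbhs0_le; rewrite divr_gt0 ?exprn_gt0.
rewrite /= subr0 normrM normfV mulrC ler_pdivrMr ?normr_gt0//.
have -> : e * `|h| = e / N ^+ 2 * `|h| * N ^+ 2.
  by rewrite mulrAC divfK// expf_neq0// gt_eqF.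
rewrite (@le_trans _ _ ((`|h| * N) ^+ 2))//.
  apply: monofrac_bound => //.
  - by rewrite mulr_ge0 ?(ltW N0)//= -ler_pdivlMr// mul1r.
  - by rewrite !mxE vi addr0 normrM ler_wpM2l// /N -addrA lerDl addr_ge0.
  - by rewrite !mxE vj addr0 normrM ler_wpM2l// /N addrAC lerDr addr_ge0.
by rewrite exprMn ler_pM2r ?exprn_gt0// expr2 ler_wpM2r.
Unshelve. all: by end_near. Qed.

(** The quotient rule off the locus x = y = 0; on it every term is 0. The derivative is again a
    combination of such fractions, of degree a + b - 2(c+1) lowered by one. When [a] or [b] is 0,
    its coefficient kills the term with the truncated predecessor. *)
Lemma is_derive_monofrac a b c v w : (c.+1.*2 + 2 <= a + b)%N ->
  is_derive v w (monofrac a b c)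
   (a%:R * w ord0 i * monofrac a.-1 b c v
    + b%:R * w ord0 j * monofrac a b.-1 c v
    - c.+1.*2%:R * (w ord0 i * monofrac a.+1 b c.+1 v
                    + w ord0 j * monofrac a b.+1 c.+1 v)).
Proof.
move=> abc.
have [q0|qN0] := eqVneq (v ord0 i ^+ 2 + v ord0 j ^+ 2) 0.
  move/eqP: q0; rewrite sqrD_eq0 => /andP[/eqP vi /eqP vj].
  have := is_derive_monofrac_axis w abc vi vj.
  by rewrite !(@monofrac_axis _ _ _ v)// !(mulr0, addr0, oppr0).
have di := is_derive_coord i v w; have dj := is_derive_coord j v w.
pose X := fun u : 'rV[R]_n => u ord0 i.
pose Y := fun u : 'rV[R]_n => u ord0 j.
pose Q := (X ^+ 2 + Y ^+ 2) ^+ c.+1.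
have dQ : is_derive v w Q _ :=
  is_deriveX c.+1 (is_deriveD (is_deriveX 2 di) (is_deriveX 2 dj)).
have QE u : Q u = (u ord0 i ^+ 2 + u ord0 j ^+ 2) ^+ c.+1.
  by rewrite /Q !exprfctE.
have QN0 : Q v != 0 by rewrite QE expf_neq0.
have dV : is_derive v w (fun u => (Q u)^-1) (- (Q v) ^- 2 *: 'D_w Q v).
  by split; [apply: derivableV => //; case: dQ|apply: deriveV => //; case: dQ].
have -> : monofrac a b c = (X ^+ a * Y ^+ b) * (fun u => (Q u)^-1).
  by apply/funext => u; rewrite /monofrac -QE !fctE.
apply: (is_derive_eq
  (is_deriveM (is_deriveM (is_deriveX a di) (is_deriveX b dj)) dV)).
rewrite (@derive_val _ _ _ _ _ _ _ dQ) QE.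
rewrite !fctE /GRing.scale /= !expr1 /monofrac -mul2n natrM.
(* Once the successor powers are split, [x ^+ a] and [x ^+ a.-1] can be independent atoms for
   [field], with no case split on [a = 0]. *)
rewrite !(exprS _ a) !(exprS _ b) !(exprS _ c.+1) !(exprS _ c).
move: (v ord0 i) (v ord0 j) (w ord0 i) (w ord0 j) qN0 => x y s t qN0.
have := expf_neq0 c qN0.
move: (_ ^+ c) (x ^+ a) (x ^+ a.-1) (y ^+ b) (y ^+ b.-1) => q xa xa1 yb yb1 q0.
by field; rewrite q0 qN0.
Qed.

Lemma cvg_monofrac a b c (F : set_system 'rV[R]_n) (x y : R) : Filter F ->
  (fun v : 'rV[R]_n => v ord0 i) @ F --> x ->
  (fun v : 'rV[R]_n => v ord0 j) @ F --> y -> x ^+ 2 + y ^+ 2 != 0 ->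
  monofrac a b c @ F --> x ^+ a * y ^+ b / (x ^+ 2 + y ^+ 2) ^+ c.+1.
Proof.
move=> FF Fx Fy qN0.
have cX (f : 'rV[R]_n -> R) m (z : R) :
  f @ F --> z -> (fun v => f v ^+ m) @ F --> z ^+ m.
  by move=> fz; exact: (cvg_comp _ _ fz (@exprn_continuous _ m _)).
apply: cvgM; first by apply: cvgM; exact: cX.
apply: cvgV; first exact: expf_neq0.
by apply: (cX); apply: cvgD; exact: cX.
Qed.

Lemma monofrac_continuous a b c : (c.+1.*2 + 1 <= a + b)%N ->
  continuous (monofrac a b c).
Proof.
move=> abc.
suff H (v : 'rV[R]_n) : monofrac a b c @ nbhs v --> monofrac a b c v.
  by move=> v; exact: H.
have ci : (fun u : 'rV[R]_n => u ord0 i) @ nbhs v --> (v ord0 i : R).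
  exact: (@coord_continuous R 1 n ord0 i).
have cj : (fun u : 'rV[R]_n => u ord0 j) @ nbhs v --> (v ord0 j : R).
  exact: (@coord_continuous R 1 n ord0 j).
have [q0|qN0] := eqVneq (v ord0 i ^+ 2 + v ord0 j ^+ 2) 0; last first.
  exact: (@cvg_monofrac a b c _ _ _ _ ci cj qN0).
move/eqP: q0; rewrite sqrD_eq0 => /andP[/eqP vi /eqP vj].
rewrite monofrac_axis//; apply/cvgr0Pnorm_le => e e0.
rewrite vi in ci; rewrite vj in cj.
(* [monofrac_bound] requires M <= 1, and its conclusion with d = 1 requires M <= e. *)
pose M : R := Num.min 1 e.
have M0 : 0 < M by rewrite lt_min ltr01.
near=> u.
rewrite (@le_trans _ _ M) ?ge_min ?lexx ?orbT//.
rewrite -[M]expr1; apply: monofrac_bound => //.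
- by rewrite (ltW M0) ge_min lexx.
- by near: u; exact: (cvgr0Pnorm_le _).1 ci _ M0.
- by near: u; exact: (cvgr0Pnorm_le _).1 cj _ M0.
Unshelve. all: by end_near. Qed.

Lemma classC_lincomb k (r s : R) (f g : 'rV[R]_n -> R) :
  classC k f -> classC k g -> classC k (fun v => r * f v + s * g v).
Proof.
elim: k f g => [|k IH] f g [fc df] [gc dg].
  by split=> //; exact: continuous_lincomb.
split; first exact: continuous_lincomb.
move=> l; have [dfl Cf] := df l; have [dgl Cg] := dg l.
have dfg v : is_derive v (delta_mx ord0 l) (fun v => r * f v + s * g v)
    (r * 'D_(delta_mx ord0 l) f v + s * 'D_(delta_mx ord0 l) g v).
  exact: (is_deriveD (is_deriveZ r (derivableP (dfl v)))
                     (is_deriveZ s (derivableP (dgl v)))).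
split=> [v|]; first by case: (dfg v).
by under eq_fun do rewrite (@derive_val _ _ _ _ _ _ _ (dfg _)); exact: IH.
Qed.

(** Each derivative costs one degree of homogeneity, and continuity at the end still needs degree
    1. *)
Lemma classC_monofrac k a b c : (c.+1.*2 + k.+1 <= a + b)%N ->
  classC k (monofrac a b c).
Proof.
elim: k a b c => [|k IH] a b c abc.
  by split=> //; exact: monofrac_continuous.
split; first by apply: monofrac_continuous; lia.
move=> l; have abc2 : (c.+1.*2 + 2 <= a + b)%N by lia.
have dG v : is_derive v (delta_mx ord0 l) (monofrac a b c) _ :=
  is_derive_monofrac v (delta_mx ord0 l) abc2.
split=> [v|]; first by case: (dG v).
under eq_fun do rewrite (@derive_val _ _ _ _ _ _ _ (dG _)).
set r := delta_mx ord0 l ord0 i; set s := delta_mx ord0 l ord0 j.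
(* This puts the derivative in the form of nested two-term combinations, as [classC_lincomb]
   expects. *)
under eq_fun do rewrite addrC -mulNr -[X in _ + X]mul1r.
do 2! apply: classC_lincomb => //; apply: IH; lia.
Qed.
End partial_fraction.

(** * Regulousness of f_k and conclusion *)

Lemma fkE (R : realType) (n k : nat) (hn : (2 <= n)%N) :
  fk k hn = @monofrac R n (Ordinal (ltnW hn)) (Ordinal hn) (2 + 2 * k) 0 0.
Proof.
apply/funext => v; rewrite /fk /=; case: ifPn => [/andP[/eqP v0 /eqP v1]|_].
  by rewrite monofrac_axis.
by rewrite /monofrac expr0 mulr1 expr1.
Qed.

Lemma rational_fk (R : realType) (n k : nat) (hn : (2 <= n)%N) :
  rational_fun (@fk R n k hn).
Proof.
set i := Ordinal (ltnW hn); set j := Ordinal hn.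
pose X l : mpoly.mpoly n R := mpoly.mpolyX R (mpoly.mnm1 l).
pose q := X i * X i + X j * X j.
have pevalX l x : peval (X l) x = x ord0 l by exact: mpoly.mevalXU.
have pevalq x : peval q x = x ord0 i ^+ 2 + x ord0 j ^+ 2.
  by rewrite /peval mpoly.mevalD !mpoly.mevalM -!/(peval _ x) !pevalX -!expr2.
exists [set x | peval q x != 0]; split.
- exists [set q]; apply/seteqP; split=> x /=.
    by move/negP/negPn/eqP => qx _ ->.
  by move=> qx; apply/negP/negPn/eqP; exact: qx.
(* At the point with all coordinates 1, [q] takes the value 2. *)
- by exists (const_mx 1); rewrite /= pevalq !mxE expr1n -mulr2n pnatr_eq0.
- exists (X i ^+ (2 + 2 * k)), q => x /= qx; split=> //.
  rewrite fkE /monofrac expr0 mulr1 expr1 pevalq.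
  by rewrite /peval rmorphXn /= -/(peval _ x) pevalX.
Qed.

Theorem theorem3p4 (R : realType) (n k : nat)
    (hk : (1 <= k)%N) (hn : (2 <= n)%N) :
  regulous R n k (fk k hn) /\
  ~ sum_of_squares (regulous R n k) (fk k hn).
Proof.
split.
  split; last exact: rational_fk.
  (* The degree condition reads 2 + (k + 1) <= 2 + 2k, which is k >= 1. *)
  by rewrite fkE; apply: classC_monofrac; lia.
move=> [m [g [greg]]]; apply: fk_not_sum_of_squares_classC => l.
by case: (greg l).
Qed.
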